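(* Let $$A_1=c_{ijij},\qquad A_2=c_{iijj},$$ $$B_1=c_{ijkl}c_{ijkl},\quad B_2=c_{iikl}c_{jjkl},\quad B_3=c_{iikl}c_{jkjl},\quad B_4=c_{kiil}c_{kjjl},$$ regarded as functions of the elastic moduli tensor $(c_{ijkl})$. Then the seven quadratic forms $A_1^2,\ A_2^2,\ A_1A_2,\ B_1,\ B_2,\ B_3,\ B_4$ form a complete basis of the quadratic invariants of the elastic moduli under $SO(3)$: they are linearly independent $SO(3)$-invariant quadratic forms, and every quadratic form in the elastic moduli that is invariant under $SO(3)$ is a linear combination of them.
   Context: Summation over repeated indices in $\{1,2,3\}$ is assumed. Let $\mathbb{E}$ be the 21-dimensional real vector space of fourth-order tensors $(c_{ijkl})$, $i,j,k,l\in\{1,2,3\}$, with the symmetries $c_{ijkl}=c_{jikl}$ and $c_{ijkl}=c_{klij}$ (no positive-definiteness is imposed). $Q\in SO(3)$ acts on $\mathbb{E}$ by $c_{ijkl}\mapsto Q_{ip}Q_{jq}Q_{kr}Q_{ls}c_{pqrs}$. A quadratic invariant under $SO(3)$ is a real quadratic form $\phi$ on $\mathbb{E}$ with $\phi(Q\cdot C)=\phi(C)$ for all $Q\in SO(3)$, $C\in\mathbb{E}$. *)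

(* Defs.v *)
From HB Require Import structures.
From mathcomp Require Import all_boot all_order all_algebra.
From mathcomp Require Import reals.
Set Implicit Arguments.
Unset Strict Implicit.
Unset Printing Implicit Defensive.
Import GRing.Theory.
Local Open Scope ring_scope.

Definition tensor4 (R : realType) :=
  {ffun 'I_3 * 'I_3 * 'I_3 * 'I_3 -> R^o}.

(* The remaining minor symmetry c_ijkl = c_ijlk follows from these two. *)
Definition elastic_sym (R : realType) : {pred tensor4 R} :=
  [pred c : tensor4 R | [forall i, forall j, forall k, forall l,
     (c (i, j, k, l) == c (j, i, k, l)) && (c (i, j, k, l) == c (k, l, i, j))]].

Arguments elastic_sym R : clear implicits.

Lemma elastic_symP (R : realType) (c : tensor4 R) :
  reflect (forall i j k l, c (i, j, k, l) = c (j, i, k, l) /\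
                           c (i, j, k, l) = c (k, l, i, j))
          (c \in elastic_sym R).
Proof.
apply: (iffP idP) => [|h].
  rewrite inE => /forallP h i j k l.
  move: (h i) => /forallP /(_ j) /forallP /(_ k) /forallP /(_ l).
  by case/andP => /eqP ? /eqP ?.
rewrite inE; apply/forallP => i; apply/forallP => j; apply/forallP => k.
by apply/forallP => l; case: (h i j k l) => <- <-; rewrite eqxx.
Qed.

Lemma elastic_sym_submod (R : realType) : GRing.submod_closed (elastic_sym R).
Proof.
split=> [|a u v /elastic_symP hu /elastic_symP hv]; apply/elastic_symP.
  by move=> i j k l; rewrite !ffunE.
move=> i j k l; rewrite !ffunE.
by case: (hu i j k l) => <- <-; case: (hv i j k l) => <- <-.
Qed.

HB.instance Definition _ (R : realType) :=
  GRing.isSubmodClosed.Build R (tensor4 R) (elastic_sym R)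
    (elastic_sym_submod R).

Record elasticity (R : realType) := Elasticity {
  moduli : tensor4 R;
  moduliP : moduli \in elastic_sym R }.

HB.instance Definition _ (R : realType) := [isSub for @moduli R].
HB.instance Definition _ (R : realType) := [Choice of elasticity R by <:].
HB.instance Definition _ (R : realType) :=
  [SubChoice_isSubLmodule of elasticity R by <:].

Definition coef (R : realType) (C : elasticity R) (i j k l : 'I_3) : R :=
  moduli C (i, j, k, l).

Definition is_SO3 (R : realType) (Q : 'M[R]_3) : Prop :=
  Q *m Q^T = 1%:M /\ \det Q = 1.

(* The tensor action makes sense for every matrix Q; the invariance below
   quantifies over SO(3) only. *)
Definition rotate_moduli (R : realType) (Q : 'M[R]_3) (C : elasticity R) :
    tensor4 R :=
  [ffun x : 'I_3 * 'I_3 * 'I_3 * 'I_3 =>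
     let: (i, j, k, l) := x in
     \sum_p \sum_q \sum_r \sum_s
        Q i p * Q j q * Q k r * Q l s * coef C p q r s].

Lemma rotate_moduliP (R : realType) (Q : 'M[R]_3) (C : elasticity R) :
  rotate_moduli Q C \in elastic_sym R.
Proof.
have hC := elastic_symP _ (moduliP C).
apply/elastic_symP => i j k l; rewrite !ffunE; split.
  rewrite exchange_big /=; do 4![apply: eq_bigr => ? _].
  by rewrite /coef -(hC _ _ _ _).1 [Q i _ * _]mulrC.
under eq_bigr => p _ do rewrite exchange_big /=.
rewrite exchange_big /=; apply: eq_bigr => r _.
under eq_bigr => p _.
  under eq_bigr => q _ do [under eq_bigr => s _ do rewrite /coef (hC _ _ _ _).2].
  rewrite exchange_big /=; over.
rewrite exchange_big /=; apply: eq_bigr => s _.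
apply: eq_bigr => p _; apply: eq_bigr => q _.
by rewrite /coef; congr (_ * _); rewrite -mulrA [LHS]mulrC !mulrA.
Qed.

Definition rotate (R : realType) (Q : 'M[R]_3) (C : elasticity R) :
    elasticity R :=
  Elasticity (rotate_moduliP Q C).

(* {biscalar E} is the library's type of R-bilinear forms E -> E -> R. *)
Definition quadratic_form (R : realType) (phi : elasticity R -> R) : Prop :=
  exists b : {biscalar elasticity R}, forall C, phi C = b C C.

Definition SO3_invariant (R : realType) (phi : elasticity R -> R) : Prop :=
  forall (Q : 'M[R]_3) (C : elasticity R),
    is_SO3 Q -> phi (rotate Q C) = phi C.

Definition quadratic_invariant (R : realType) (phi : elasticity R -> R) : Prop :=
  quadratic_form phi /\ SO3_invariant phi.

Section Invariants.
Variable R : realType.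
Implicit Type C : elasticity R.

(* Each index repeated in a product of moduli is summed over 'I_3. *)
Definition A1 C : R := \sum_i \sum_j coef C i j i j.
Definition A2 C : R := \sum_i \sum_j coef C i i j j.

Definition B1 C : R :=
  \sum_i \sum_j \sum_k \sum_l coef C i j k l * coef C i j k l.
Definition B2 C : R :=
  \sum_i \sum_j \sum_k \sum_l coef C i i k l * coef C j j k l.
Definition B3 C : R :=
  \sum_i \sum_j \sum_k \sum_l coef C i i k l * coef C j k j l.
Definition B4 C : R :=
  \sum_i \sum_j \sum_k \sum_l coef C k i i l * coef C k j j l.

Definition seven_forms : 7.-tuple (elasticity R -> R) :=
  [tuple (fun C => A1 C ^+ 2); (fun C => A2 C ^+ 2); (fun C => A1 C * A2 C);
         B1; B2; B3; B4].
End Invariants.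

(* Main.v *)
(* The space of elasticity tensors is spanned by the quartics u_i u_j u_k u_l and
   the tensors v_i v_j delta_kl + delta_ij v_k v_l, on which rotations act through
   u and v. So an invariant quadratic form is determined by its polar form on pairs
   of such generators, a function of two vectors. Invariance reduces these to
   u = (a, 0, 0), v = (b, c, 0), and the rotation diag(1, -1, -1) makes the result
   even in c; homogeneity then leaves 3 + 2 + 2 = 7 constants. Evaluating the seven
   given forms at these seven places yields an invertible 7 x 7 matrix, which gives
   both linear independence and spanning. *)
Require Import Defs.
From HB Require Import structures.
From mathcomp Require Import all_boot all_order all_algebra.
From mathcomp Require Import reals ring lra.
Import Order.TTheory GRing.Theory Num.Theory.
Local Open Scope ring_scope.

Local Notation i0 := (ord0 : 'I_3).
Local Notation i1 := (lift ord0 ord0 : 'I_3).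
Local Notation i2 := (lift ord0 (lift ord0 ord0) : 'I_3).

Section ElasticTensors.
Variable R : realType.
Implicit Types (C D : elasticity R) (phi psi : elasticity R -> R).
Implicit Types (u v : 'cV[R]_3) (Q X Y Z : 'M[R]_3).

(** * Coordinates of elasticity tensors and the rotation action *)

Lemma coef_sym C i j k l :
  coef C i j k l = coef C j i k l /\ coef C i j k l = coef C k l i j.
Proof. exact: (elastic_symP _ (moduliP C)). Qed.

(** Exchange the two pairs, swap the first two indices, and exchange back. *)
Lemma coef_symr C i j k l : coef C i j k l = coef C i j l k.
Proof.
by rewrite (coef_sym C i j k l).2 (coef_sym C k l i j).1 -(coef_sym C i j l k).2.
Qed.

Lemma coef_add C D i j k l : coef (C + D) i j k l = coef C i j k l + coef D i j k l.
Proof.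
have E : moduli (C + D) = moduli C + moduli D.
  exact: (raddfD (\val : elasticity R -> tensor4 R)).
by rewrite /coef E ffunE.
Qed.

Lemma coef_scale a C i j k l : coef (a *: C) i j k l = a * coef C i j k l.
Proof.
have E : moduli (a *: C) = a *: moduli C by exact: GRing.valZ.
by rewrite /coef E ffunE.
Qed.

Lemma coef_eq C D : (forall i j k l, coef C i j k l = coef D i j k l) -> C = D.
Proof. by move=> h; apply/val_inj/ffunP => -[[[i j] k] l]; exact: h. Qed.

Lemma coef_rotate Q C i j k l : coef (rotate Q C) i j k l =
  \sum_p \sum_q \sum_r \sum_s Q i p * Q j q * Q k r * Q l s * coef C p q r s.
Proof. by rewrite /coef /= ffunE. Qed.

Lemma rotateD Q C D : rotate Q (C + D) = rotate Q C + rotate Q D.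
Proof.
apply: coef_eq => i j k l; rewrite coef_add !coef_rotate.
rewrite -big_split; apply: eq_bigr => p _; rewrite -big_split; apply: eq_bigr => q _.
rewrite -big_split; apply: eq_bigr => r _; rewrite -big_split; apply: eq_bigr => s _.
by rewrite coef_add mulrDr.
Qed.

Definition dyad u : 'M[R]_3 := u *m u^T.

Lemma dyadE u i j : dyad u i j = u i ord0 * u j ord0.
Proof. by rewrite mxE big_ord1 !mxE. Qed.

Lemma dyad_rotate Q u : dyad (Q *m u) = Q *m dyad u *m Q^T.
Proof. by rewrite /dyad trmx_mul !mulmxA. Qed.

Lemma conjmxE Q X i j : (Q *m X *m Q^T) i j = \sum_p \sum_q Q i p * Q j q * X p q.
Proof.
rewrite mxE exchange_big; apply: eq_bigr => q _ /=.
rewrite !mxE big_distrl; apply: eq_bigr => p _ /=; ring.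
Qed.

(** The rotation acts on a tensor product of two matrices by conjugating each factor. Both kinds of
    generators are built from such products, so this yields their rotation rules. *)
Lemma sum_conjmx Q X Y i j k l :
  \sum_p \sum_q \sum_r \sum_s Q i p * Q j q * Q k r * Q l s * (X p q * Y r s) =
  (Q *m X *m Q^T) i j * (Q *m Y *m Q^T) k l.
Proof.
rewrite !conjmxE big_distrl; apply: eq_bigr => p _ /=.
rewrite big_distrl; apply: eq_bigr => q _ /=.
rewrite big_distrr; apply: eq_bigr => r _ /=.
rewrite big_distrr; apply: eq_bigr => s _ /=; ring.
Qed.

(** * Generators *)

Definition quartic_tensor u : tensor4 R :=
  [ffun x : 'I_3 * 'I_3 * 'I_3 * 'I_3 =>
     let: (i, j, k, l) := x in dyad u i j * dyad u k l].

Lemma quartic_tensorP u : quartic_tensor u \in elastic_sym R.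
Proof. by apply/elastic_symP => i j k l; rewrite !ffunE !dyadE; split; ring. Qed.

Definition quartic u : elasticity R := Elasticity (quartic_tensorP u).

Definition dyad_delta_tensor u : tensor4 R :=
  [ffun x : 'I_3 * 'I_3 * 'I_3 * 'I_3 =>
     let: (i, j, k, l) := x in
     dyad u i j * (1%:M : 'M_3) k l + (1%:M : 'M_3) i j * dyad u k l].

Lemma dyad_delta_tensorP u : dyad_delta_tensor u \in elastic_sym R.
Proof.
apply/elastic_symP => i j k l; rewrite !ffunE !dyadE !mxE (eq_sym j i); split; ring.
Qed.

Definition dyad_delta u : elasticity R := Elasticity (dyad_delta_tensorP u).

Lemma coef_quartic u i j k l : coef (quartic u) i j k l = dyad u i j * dyad u k l.
Proof. by rewrite /coef /= ffunE. Qed.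

Lemma coef_dyad_delta u i j k l : coef (dyad_delta u) i j k l =
  dyad u i j * (1%:M : 'M_3) k l + (1%:M : 'M_3) i j * dyad u k l.
Proof. by rewrite /coef /= ffunE. Qed.

Lemma rotate_quartic Q u : rotate Q (quartic u) = quartic (Q *m u).
Proof.
apply: coef_eq => i j k l; rewrite coef_rotate coef_quartic dyad_rotate -sum_conjmx.
by do 4![apply: eq_bigr => ? _]; rewrite coef_quartic.
Qed.

(** Conjugation by an orthogonal matrix fixes the identity, so only the dyad factor moves. *)
Lemma rotate_dyad_delta Q u : is_SO3 Q ->
  rotate Q (dyad_delta u) = dyad_delta (Q *m u).
Proof.
case=> QQ _; apply: coef_eq => i j k l.
have E : Q *m 1%:M *m Q^T = 1%:M by rewrite mulmx1.
rewrite coef_rotate coef_dyad_delta dyad_rotate -E -!sum_conjmx -big_split.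
apply: eq_bigr => p _; rewrite -big_split; apply: eq_bigr => q _.
rewrite -big_split; apply: eq_bigr => r _; rewrite -big_split; apply: eq_bigr => s _.
by rewrite coef_dyad_delta mulrDr.
Qed.

(** * Explicit vectors, plane rotations and the normal position of a pair of vectors *)

Definition vec3 (x y z : R) : 'cV[R]_3 := \col_(i < 3) nth 0 [:: x; y; z] i.

Definition mat3 (r : seq (seq R)) : 'M[R]_3 :=
  \matrix_(i < 3, j < 3) nth 0 (nth [::] r i) j.

Lemma ord3P (P : 'I_3 -> Prop) :
  P i0 -> P i1 -> P i2 ->
  forall i, P i.
Proof.
move=> h0 h1 h2 [[|[|[|//]]] hi].
- by have <- : i0 = Ordinal hi by apply: val_inj.
- by have <- : i1 = Ordinal hi by apply: val_inj.
- by have <- : i2 = Ordinal hi by apply: val_inj.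
Qed.

Lemma sum3 (F : 'I_3 -> R) :
  \sum_i F i = F i0 + F i1 + F i2.
Proof. by rewrite !big_ord_recl big_ord0 addr0 addrA. Qed.

Lemma vec3_eta u :
  u = vec3 (u i0 ord0) (u i1 ord0) (u i2 ord0).
Proof. by apply/matrixP => i j; rewrite ord1 mxE; move: i; apply: ord3P. Qed.

Lemma mat3_vec3 a b c d e f g h k x y z :
  mat3 [:: [:: a; b; c]; [:: d; e; f]; [:: g; h; k]] *m vec3 x y z =
  vec3 (a * x + b * y + c * z) (d * x + e * y + f * z) (g * x + h * y + k * z).
Proof.
by apply/matrixP => i j; rewrite ord1 !mxE sum3 !mxE; move: i; apply: ord3P.
Qed.

Lemma det_mat3 a b c d e f g h k :
  \det (mat3 [:: [:: a; b; c]; [:: d; e; f]; [:: g; h; k]]) =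
  a * (e * k - f * h) - b * (d * k - f * g) + c * (d * h - e * g).
Proof.
rewrite (expand_det_row _ ord0) sum3 /cofactor.
rewrite !(expand_det_row _ ord0) !big_ord_recl !big_ord0 /cofactor !det_mx11 !mxE /=.
by rewrite /bump /=; ring.
Qed.

Definition rot12 (c s : R) := mat3 [:: [:: c; s; 0]; [:: - s; c; 0]; [:: 0; 0; 1]].
Definition rot23 (c s : R) := mat3 [:: [:: 1; 0; 0]; [:: 0; c; s]; [:: 0; - s; c]].

Lemma rot12_SO3 c s : c ^+ 2 + s ^+ 2 = 1 -> is_SO3 (rot12 c s).
Proof.
move=> h; split; last by rewrite det_mat3; lra.
apply/matrixP; apply: ord3P; apply: ord3P; rewrite mxE sum3 !mxE /= ?mulr1n ?mulr0n; nra.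
Qed.

Lemma rot23_SO3 c s : c ^+ 2 + s ^+ 2 = 1 -> is_SO3 (rot23 c s).
Proof.
move=> h; split; last by rewrite det_mat3; lra.
apply/matrixP; apply: ord3P; apply: ord3P; rewrite mxE sum3 !mxE /= ?mulr1n ?mulr0n; nra.
Qed.

Lemma rot12_vec3 c s x y z :
  rot12 c s *m vec3 x y z = vec3 (c * x + s * y) (c * y - s * x) z.
Proof. by rewrite mat3_vec3; congr vec3; ring. Qed.

Lemma rot23_vec3 c s x y z :
  rot23 c s *m vec3 x y z = vec3 x (c * y + s * z) (c * z - s * y).
Proof. by rewrite mat3_vec3; congr vec3; ring. Qed.

(** A Givens rotation: normalizing (x, y) gives the cosine and sine that turn it onto the first
    axis. For the zero vector the identity rotation serves. *)
Lemma givens (x y : R) : exists c s : R, c ^+ 2 + s ^+ 2 = 1 /\ c * y - s * x = 0.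
Proof.
have [/eqP h|h] := boolP (x ^+ 2 + y ^+ 2 == 0).
  by exists 1, 0; split; [ring|nra].
have h0 : 0 <= x ^+ 2 + y ^+ 2 by rewrite addr_ge0 ?sqr_ge0.
have r2 := sqr_sqrtr h0; set r := Num.sqrt _ in r2.
have rn0 : r != 0 by rewrite -sqrf_eq0 r2.
exists (x / r), (y / r); split; last by field.
by rewrite !expr_div_n -mulrDl r2 divff.
Qed.

(* Three plane rotations, about the axes 1, 3 and 1, bring any pair (u, v) to the
   form (a, 0, 0), (b, c, 0). *)
Lemma SO3_pair_ind (P : 'cV[R]_3 -> 'cV[R]_3 -> Prop) :
  (forall Q u v, is_SO3 Q -> P (Q *m u) (Q *m v) -> P u v) ->
  (forall a b c, P (vec3 a 0 0) (vec3 b c 0)) -> forall u v, P u v.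
Proof.
(* The rotations are peeled off in reverse order. In [P1] the rotation about axis 1 leaves the first
   vector alone and clears the third coordinate of the second; [P2] clears the second coordinate of
   u, and the final step its third. *)
move=> PQ P0; have P1 x x' y' z' : P (vec3 x 0 0) (vec3 x' y' z').
  have [c [s [/rot23_SO3 cs e]]] := givens y' z'.
  by apply: (PQ _ _ _ cs); rewrite !rot23_vec3 e !mulr0 subr0 addr0.
have P2 x y x' y' z' : P (vec3 x y 0) (vec3 x' y' z').
  have [c [s [/rot12_SO3 cs e]]] := givens x y.
  by apply: (PQ _ _ _ cs); rewrite !rot12_vec3 e.
move=> u v; rewrite (vec3_eta u) (vec3_eta v).
have [c [s [/rot23_SO3 cs e]]] := givens (u i1 ord0) (u i2 ord0).
by apply: (PQ _ _ _ cs); rewrite !rot23_vec3 e.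
Qed.

(** * Spanning by the generators *)

(** Sorting each index pair, then the two pairs by the lexicographic code [3 * i + j], leaves the 21
    independent moduli. *)
Lemma coef_eq_canonical C D :
  (forall i j k l : 'I_3, (i <= j)%N -> (k <= l)%N -> (3 * i + j <= 3 * k + l)%N ->
     coef C i j k l = coef D i j k l) -> C = D.
Proof.
move=> h; have h1 (i j k l : 'I_3) : (i <= j)%N -> (k <= l)%N ->
    coef C i j k l = coef D i j k l.
  move=> ij kl; have [le|/ltnW le] := leqP (3 * i + j) (3 * k + l); first exact: h.
  by rewrite (coef_sym C _ _ _ _).2 (coef_sym D _ _ _ _).2; exact: h.
have h2 (i j k l : 'I_3) : (i <= j)%N -> coef C i j k l = coef D i j k l.
  move=> ij; have [le|/ltnW le] := leqP k l; first exact: h1.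
  by rewrite (coef_symr C) (coef_symr D); exact: h1.
apply: coef_eq => i j k l; have [le|/ltnW le] := leqP i j; first exact: h2.
by rewrite (coef_sym C _ _ _ _).1 (coef_sym D _ _ _ _).1; exact: h2.
Qed.

Lemma dyad_vec3 x y z i j :
  dyad (vec3 x y z) i j = nth 0 [:: x; y; z] i * nth 0 [:: x; y; z] j.
Proof. by rewrite dyadE !mxE. Qed.

(* The coefficients invert the 21 x 21 system of the listed generators: the
   [dyad_delta] terms absorb the failure c_iijk <> c_ijik of total symmetry, and
   the quartics span the fifteen-dimensional space of totally symmetric tensors. *)
Definition generator_decomposition C : seq (R * elasticity R) :=
  let c := coef C in
  [::
    ((2 * c i0 i0 i0 i0 - c i0 i0 i0 i1 - c i0 i0 i0 i2 - 2 * c i0 i0 i1 i1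
      - 2 * c i0 i0 i2 i2 - 2 * c i0 i1 i0 i2 + c i0 i1 i1 i1
      + 2 * c i0 i1 i1 i2 + 2 * c i0 i2 i1 i2 + c i0 i2 i2 i2
      + 2 * c i1 i1 i2 i2 - 2 * c i1 i2 i1 i2) / 2, quartic (vec3 1 0 0));
    ((4 * c i0 i0 i0 i1 - 2 * c i0 i0 i1 i1 + 2 * c i0 i0 i2 i2
      - 2 * c i0 i1 i0 i2 - 4 * c i0 i1 i1 i1 + 2 * c i0 i1 i1 i2
      - 2 * c i0 i2 i0 i2 + 2 * c i0 i2 i1 i2 + 2 * c i1 i1 i1 i1
      - c i1 i1 i1 i2 - 2 * c i1 i1 i2 i2 + c i1 i2 i2 i2) / 2,
      quartic (vec3 0 1 0));
    (2 * c i0 i0 i0 i2 + c i0 i0 i1 i1 - c i0 i0 i2 i2 - c i0 i1 i0 i1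
      - c i0 i1 i0 i2 + c i0 i1 i1 i2 + c i0 i2 i1 i2 - 2 * c i0 i2 i2 i2
      + 2 * c i1 i1 i1 i2 - c i1 i1 i2 i2 - 2 * c i1 i2 i2 i2 + c i2 i2 i2 i2,
      quartic (vec3 0 0 1));
    ((2 * c i0 i0 i0 i1 + c i0 i1 i0 i1 + c i0 i1 i0 i2 - c i0 i1 i1 i1
      - c i0 i1 i1 i2 - c i0 i1 i2 i2 - c i0 i2 i1 i2) / 2,
      quartic (vec3 1 1 0));
    ((-2 * c i0 i0 i0 i1 + 3 * c i0 i1 i0 i1 + 3 * c i0 i1 i0 i2 - c i0 i1 i1 i1
      - 3 * c i0 i1 i1 i2 + 3 * c i0 i1 i2 i2 - 3 * c i0 i2 i1 i2) / 6,
      quartic (vec3 1 (-1) 0));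
    ((2 * c i0 i0 i0 i2 + c i0 i1 i0 i2 - c i0 i1 i1 i2 + c i0 i2 i0 i2
      - c i0 i2 i1 i1 - c i0 i2 i1 i2 - c i0 i2 i2 i2) / 2,
      quartic (vec3 1 0 1));
    ((-2 * c i0 i0 i0 i2 + 3 * c i0 i1 i0 i2 - 3 * c i0 i1 i1 i2
      + 3 * c i0 i2 i0 i2 + 3 * c i0 i2 i1 i1 - 3 * c i0 i2 i1 i2
      - c i0 i2 i2 i2) / 6, quartic (vec3 1 0 (-1)));
    ((- c i0 i0 i1 i2 + c i0 i1 i0 i2 - c i0 i1 i1 i2 - c i0 i2 i1 i2
      + 2 * c i1 i1 i1 i2 + c i1 i2 i1 i2 - c i1 i2 i2 i2) / 2,
      quartic (vec3 0 1 1));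
    ((3 * c i0 i0 i1 i2 + 3 * c i0 i1 i0 i2 - 3 * c i0 i1 i1 i2
      - 3 * c i0 i2 i1 i2 - 2 * c i1 i1 i1 i2 + 3 * c i1 i2 i1 i2
      - c i1 i2 i2 i2) / 6, quartic (vec3 0 1 (-1)));
    ((- c i0 i0 i0 i1 + c i0 i1 i1 i1) / 6, quartic (vec3 1 2 0));
    ((- c i0 i0 i0 i2 + c i0 i2 i2 i2) / 6, quartic (vec3 1 0 2));
    ((- c i1 i1 i1 i2 + c i1 i2 i2 i2) / 6, quartic (vec3 0 1 2));
    ((c i0 i1 i1 i2 + c i0 i2 i1 i2) / 2, quartic (vec3 1 1 1));
    ((- c i0 i1 i0 i2 + c i0 i2 i1 i2) / 2, quartic (vec3 1 1 (-1)));
    ((- c i0 i1 i0 i2 + c i0 i1 i1 i2) / 2, quartic (vec3 1 (-1) 1));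
    ((c i0 i0 i1 i1 + c i0 i0 i2 i2 - c i0 i1 i0 i1 + 2 * c i0 i1 i1 i2
      - 2 * c i0 i1 i2 i2 - c i0 i2 i0 i2 - 2 * c i0 i2 i1 i1
      + 2 * c i0 i2 i1 i2 - c i1 i1 i2 i2 + c i1 i2 i1 i2) / 2,
      dyad_delta (vec3 1 0 0));
    ((c i0 i0 i1 i1 - 2 * c i0 i0 i1 i2 - c i0 i0 i2 i2 - c i0 i1 i0 i1
      + 2 * c i0 i1 i0 i2 - 2 * c i0 i1 i2 i2 + c i0 i2 i0 i2
      + 2 * c i0 i2 i1 i2 + c i1 i1 i2 i2 - c i1 i2 i1 i2) / 2,
      dyad_delta (vec3 0 1 0));
    ((- c i0 i0 i1 i1 - 2 * c i0 i0 i1 i2 + c i0 i0 i2 i2 + c i0 i1 i0 i1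
      + 2 * c i0 i1 i0 i2 + 2 * c i0 i1 i1 i2 - c i0 i2 i0 i2
      - 2 * c i0 i2 i1 i1 + c i1 i1 i2 i2 - c i1 i2 i1 i2) / 2,
      dyad_delta (vec3 0 0 1));
    (c i0 i1 i2 i2 - c i0 i2 i1 i2, dyad_delta (vec3 1 1 0));
    (- c i0 i1 i1 i2 + c i0 i2 i1 i1, dyad_delta (vec3 1 0 1));
    (c i0 i0 i1 i2 - c i0 i1 i0 i2, dyad_delta (vec3 0 1 1))].

Lemma coef_lincomb (s : seq (R * elasticity R)) i j k l :
  coef (\sum_(x <- s) x.1 *: x.2) i j k l = \sum_(x <- s) x.1 * coef x.2 i j k l.
Proof.
elim: s => [|x s IH]; last by rewrite !big_cons -IH -coef_scale; exact: coef_add.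
by rewrite !big_nil -[in LHS](scale0r 0) coef_scale mul0r.
Qed.

Lemma generator_decompositionE C :
  C = \sum_(x <- generator_decomposition C) x.1 *: x.2.
Proof.
apply: coef_eq_canonical => i j k l; rewrite coef_lincomb !big_cons big_nil /=.
rewrite !coef_quartic !coef_dyad_delta !dyad_vec3 !mxE.
(* The ordering hypotheses discard all but 21 index choices. The decomposition mentions sorted
   moduli only, so each remaining case is a linear identity among these. *)
move: i j k l; do 4 apply: ord3P => //; move=> _ _ _ /=; lra.
Qed.

(** Every term of the decomposition is a multiple of a generator. Spanning is used in this form,
    once for each argument of a polar form. *)
Lemma linear_form_eq0 (f : elasticity R -> R) : linear_for *%R f ->
  (forall u, f (quartic u) = 0) -> (forall u, f (dyad_delta u) = 0) ->
  forall C, f C = 0.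
Proof.
move=> lin fq fd C.
pose g : {scalar elasticity R} :=
  HB.pack f (GRing.isLinear.Build _ _ _ _ f lin).
have -> : f C = \sum_(x <- generator_decomposition C) x.1 * f x.2.
  rewrite [in LHS](generator_decompositionE C) -[f]/(g : _ -> _) linear_sum.
  by apply: eq_bigr => x _; rewrite linearZ.
by rewrite !big_cons big_nil /= !fq !fd !mulr0 !addr0.
Qed.

(** * Quadratic forms and the seven invariants *)

Lemma quadratic_formM (f g : elasticity R -> R) :
  linear_for *%R f -> linear_for *%R g -> quadratic_form (fun C => f C * g C).
Proof.
move=> lf lg; pose b C D := f C * g D.
have lb : bilinear_for *%R *%R b.
  by split=> C a D E; rewrite /b ?lf ?lg /=; ring.
by exists (HB.pack_for {biscalar elasticity R} b
  (bilinear_isBilinear.Build _ _ _ _ _ _ b lb)).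
Qed.

Lemma quadratic_formZD a phi psi : quadratic_form phi -> quadratic_form psi ->
  quadratic_form (fun C => a * phi C + psi C).
Proof.
move=> [b hb] [c hc]; pose d C D := a * b C D + c C D.
have ld : bilinear_for *%R *%R d.
  split=> C x D E; rewrite /d ?linearPl ?linearPr /=; ring.
exists (HB.pack_for {biscalar elasticity R} d
  (bilinear_isBilinear.Build _ _ _ _ _ _ d ld)).
by move=> C; rewrite hb hc.
Qed.

Lemma quadratic_form_eq phi psi : phi =1 psi -> quadratic_form phi -> quadratic_form psi.
Proof. by move=> e [b hb]; exists b => C; rewrite -e. Qed.

Lemma quadratic_form0 : quadratic_form (fun _ : elasticity R => 0).
Proof.
have l0 : linear_for *%R (fun _ : elasticity R => 0 : R) by move=> ? ? ?; ring.
by apply: quadratic_form_eq (quadratic_formM _ _ l0 l0) => C; rewrite mulr0.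
Qed.

Lemma quadratic_form_sum (I : finType) (F : I -> elasticity R -> R) :
  (forall i, quadratic_form (F i)) -> quadratic_form (fun C => \sum_i F i C).
Proof.
move=> h; elim: (index_enum I) => [|i s IH].
  by apply: quadratic_form_eq quadratic_form0 => C; rewrite big_nil.
apply: quadratic_form_eq (quadratic_formZD 1 _ _ (h i) IH) => C.
by rewrite big_cons mul1r.
Qed.

Lemma linear_for_sum (I : finType) (F : I -> elasticity R -> R) :
  (forall i, linear_for *%R (F i)) -> linear_for *%R (fun C => \sum_i F i C).
Proof.
move=> h a C D; rewrite big_distrr -big_split.
by apply: eq_bigr => i _; exact: h.
Qed.

Lemma linear_coef i j k l : linear_for *%R (fun C => coef C i j k l).
Proof. by move=> a C D; rewrite coef_add coef_scale. Qed.

Lemma linear_A1 : linear_for *%R (@A1 R).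
Proof. by do 2![apply: linear_for_sum => ?]; exact: linear_coef. Qed.

Lemma linear_A2 : linear_for *%R (@A2 R).
Proof. by do 2![apply: linear_for_sum => ?]; exact: linear_coef. Qed.

Lemma quadratic_seven_forms n : quadratic_form (tnth (seven_forms R) n).
Proof.
case: n => [[|[|[|[|[|[|[|//]]]]]]] hn]; rewrite (tnth_nth (fun=> 0)) /=.
- exact: (quadratic_formM _ _ linear_A1 linear_A1).
- exact: (quadratic_formM _ _ linear_A2 linear_A2).
- exact: (quadratic_formM _ _ linear_A1 linear_A2).
all: by do 4![apply: quadratic_form_sum => ?]; apply: quadratic_formM; exact: linear_coef.
Qed.

(** * Invariance of the seven forms through contractions *)

Lemma SO3_tr Q : is_SO3 Q -> Q^T *m Q = 1%:M.
Proof. by case=> /mulmx1C. Qed.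

Lemma mxtrace_conj Q X : is_SO3 Q -> \tr (Q *m X *m Q^T) = \tr X.
Proof. by move=> /SO3_tr QQ; rewrite mxtrace_mulC mulmxA QQ mul1mx. Qed.

(** The Frobenius inner product. *)
Definition mxdot X Y : R := \sum_i \sum_j X i j * Y i j.

Lemma mxdotE X Y : mxdot X Y = \tr (X *m Y^T).
Proof.
by apply: eq_bigr => i _; rewrite mxE; apply: eq_bigr => j _; rewrite mxE.
Qed.

Lemma mxdot_conj Q X Y : is_SO3 Q ->
  mxdot (Q *m X *m Q^T) (Q *m Y *m Q^T) = mxdot X Y.
Proof.
move=> hQ; rewrite !mxdotE -(mxtrace_conj Q (X *m Y^T)) //.
by rewrite !trmx_mul trmxK !mulmxA -(mulmxA _ Q^T Q) SO3_tr // mulmx1.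
Qed.

(** Invariance of the trace under conjugation, spelled out in sums so that [F] may absorb the
    factors rotating the uncontracted indices. *)
Lemma sum_contract Q (F : 'I_3 -> 'I_3 -> R) : is_SO3 Q ->
  \sum_i \sum_p \sum_q Q i p * Q i q * F p q = \sum_p F p p.
Proof.
move=> hQ; have := mxtrace_conj Q (\matrix_(p, q) F p q) hQ.
rewrite /mxtrace => E; transitivity (\sum_p (\matrix_(p, q) F p q) p p).
  rewrite -E; apply: eq_bigr => i _; rewrite conjmxE.
  by do 2![apply: eq_bigr => ? _]; rewrite mxE.
by apply: eq_bigr => i _; rewrite mxE.
Qed.

(** The dilatation tensor and the Voigt tensor, the second-order contractions of the moduli. All
    seven forms except [B1] are expressed through them. *)
Definition dilatation_mx C : 'M[R]_3 := \matrix_(k, l) \sum_i coef C i i k l.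
Definition voigt_mx C : 'M[R]_3 := \matrix_(k, l) \sum_i coef C i k i l.

Lemma dilatation_mx_rotate Q C : is_SO3 Q ->
  dilatation_mx (rotate Q C) = Q *m dilatation_mx C *m Q^T.
Proof.
move=> hQ; apply/matrixP => k l; rewrite conjmxE mxE.
under eq_bigr do rewrite coef_rotate.
transitivity (\sum_i \sum_p \sum_q Q i p * Q i q *
    (\sum_r \sum_s Q k r * Q l s * coef C p q r s)).
  do 3![apply: eq_bigr => ? _]; rewrite big_distrr; apply: eq_bigr => ? _.
  by rewrite big_distrr; apply: eq_bigr => ? _ /=; ring.
rewrite sum_contract // exchange_big; apply: eq_bigr => r _.
rewrite exchange_big; apply: eq_bigr => s _.
by rewrite mxE big_distrr.
Qed.

Lemma voigt_mx_rotate Q C : is_SO3 Q ->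
  voigt_mx (rotate Q C) = Q *m voigt_mx C *m Q^T.
Proof.
move=> hQ; apply/matrixP => k l; rewrite conjmxE mxE.
under eq_bigr do rewrite coef_rotate.
transitivity (\sum_i \sum_p \sum_r Q i p * Q i r *
    (\sum_q \sum_s Q k q * Q l s * coef C p q r s)).
  (* The contracted index now occupies the first and third places, so the sums over q and r are
     exchanged before regrouping. *)
  do 2![apply: eq_bigr => ? _]; rewrite exchange_big; apply: eq_bigr => ? _.
  rewrite big_distrr; apply: eq_bigr => ? _.
  by rewrite big_distrr; apply: eq_bigr => ? _ /=; ring.
rewrite sum_contract // exchange_big; apply: eq_bigr => r _.
rewrite exchange_big; apply: eq_bigr => s _.
by rewrite mxE big_distrr.
Qed.

Lemma A1E C : A1 C = \tr (voigt_mx C).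
Proof. by rewrite /A1 exchange_big; apply: eq_bigr => k _; rewrite mxE. Qed.

Lemma A2E C : A2 C = \tr (dilatation_mx C).
Proof. by rewrite /A2 exchange_big; apply: eq_bigr => k _; rewrite mxE. Qed.

Lemma mxdot_sum (f g : 'I_3 -> 'I_3 -> 'I_3 -> R) :
  \sum_i \sum_j \sum_k \sum_l f i k l * g j k l =
  mxdot (\matrix_(k, l) \sum_i f i k l) (\matrix_(k, l) \sum_j g j k l).
Proof.
under eq_bigr do rewrite exchange_big; rewrite exchange_big.
apply: eq_bigr => k _ /=; under eq_bigr do rewrite exchange_big.
rewrite exchange_big; apply: eq_bigr => l _ /=.
by rewrite !mxE big_distrl; apply: eq_bigr => i _; rewrite big_distrr.
Qed.

Lemma B2E C : B2 C = mxdot (dilatation_mx C) (dilatation_mx C).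
Proof. exact: mxdot_sum. Qed.

Lemma B3E C : B3 C = mxdot (dilatation_mx C) (voigt_mx C).
Proof. exact: mxdot_sum. Qed.

Lemma B4E C : B4 C = mxdot (voigt_mx C) (voigt_mx C).
Proof.
rewrite -mxdot_sum; do 4![apply: eq_bigr => ? _].
(* The minor symmetry turns c_kiil into the Voigt contraction c_ikil. *)
by rewrite (coef_sym _ _ _ _ _).1 [X in _ * X](coef_sym _ _ _ _ _).1.
Qed.

(** The rotation is removed one index pair at a time: [X] has only the last pair rotated, [Y] has
    none, and each passage is a conjugation, which preserves the Frobenius product. *)
Lemma B1_rotate Q C : is_SO3 Q -> B1 (rotate Q C) = B1 C.
Proof.
move=> hQ; pose X k l := \matrix_(p, q) \sum_r \sum_s Q k r * Q l s * coef C p q r s.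
pose Y p q := \matrix_(r, s) coef C p q r s.
have XE k l p q : X k l p q = (Q *m Y p q *m Q^T) k l.
  by rewrite conjmxE mxE; do 2![apply: eq_bigr => ? _]; rewrite mxE.
have cE i j k l : coef (rotate Q C) i j k l = (Q *m X k l *m Q^T) i j.
  rewrite coef_rotate conjmxE; do 2![apply: eq_bigr => ? _].
  rewrite mxE big_distrr; apply: eq_bigr => ? _.
  by rewrite big_distrr; apply: eq_bigr => ? _ /=; ring.
transitivity (\sum_k \sum_l mxdot (X k l) (X k l)).
  transitivity (\sum_k \sum_l mxdot (Q *m X k l *m Q^T) (Q *m X k l *m Q^T)).
    rewrite /B1 /mxdot; under eq_bigr do rewrite exchange_big.
    rewrite exchange_big; apply: eq_bigr => k _ /=.
    under eq_bigr do rewrite exchange_big.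
    rewrite exchange_big; apply: eq_bigr => l _ /=.
    by do 2![apply: eq_bigr => ? _]; rewrite !cE.
  by do 2![apply: eq_bigr => ? _]; rewrite mxdot_conj.
transitivity (\sum_p \sum_q mxdot (Y p q) (Y p q)).
  transitivity (\sum_p \sum_q mxdot (Q *m Y p q *m Q^T) (Q *m Y p q *m Q^T)).
    rewrite /mxdot; under eq_bigr do rewrite exchange_big.
    rewrite exchange_big; apply: eq_bigr => p _ /=.
    under eq_bigr do rewrite exchange_big.
    rewrite exchange_big; apply: eq_bigr => q _ /=.
    by do 2![apply: eq_bigr => ? _]; rewrite !XE.
  by do 2![apply: eq_bigr => ? _]; rewrite mxdot_conj.
by do 4![apply: eq_bigr => ? _]; rewrite mxE.
Qed.

Lemma invariant_seven_forms n : SO3_invariant (tnth (seven_forms R) n).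
Proof.
move=> Q C hQ; case: n => [[|[|[|[|[|[|[|//]]]]]]] hn]; rewrite (tnth_nth (fun=> 0)) /=.
all: rewrite ?B2E ?B3E ?B4E ?A1E ?A2E ?B1_rotate //.
all: by rewrite ?dilatation_mx_rotate ?voigt_mx_rotate // ?mxdot_conj ?mxtrace_conj.
Qed.

(** * Vanishing of an invariant from seven values *)

(** Written from values of [phi] alone, so that no bilinear form has to be chosen; when
    [phi C = b C C] it equals [b C D + b D C]. *)
Definition polar phi C D := phi (C + D) - phi C - phi D.

Lemma polarC phi C D : polar phi C D = polar phi D C.
Proof. by rewrite /polar (addrC C); ring. Qed.

Lemma polar_linear phi C : quadratic_form phi -> linear_for *%R (polar phi C).
Proof.
case=> b hb a D E.
have h (F G : elasticity R) : polar phi F G = b F G + b G F.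
  by rewrite /polar !hb linearDl !linearDr /=; ring.
by rewrite !h linearPl linearPr /=; ring.
Qed.

Lemma quadratic_form_polar0 phi : quadratic_form phi ->
  (forall C D, polar phi C D = 0) -> forall C, phi C = 0.
Proof.
case=> b hb h C; have := h C C.
by rewrite /polar !hb linearDl !linearDr /=; lra.
Qed.

Lemma polar_rotate phi Q C D : SO3_invariant phi -> is_SO3 Q ->
  polar phi (rotate Q C) (rotate Q D) = polar phi C D.
Proof. by move=> inv hQ; rewrite /polar -rotateD !inv. Qed.

Definition e1 : 'cV[R]_3 := vec3 1 0 0.
Definition e2 : 'cV[R]_3 := vec3 0 1 0.

(** One pair for each constant that survives the reduction: three between quartics, two mixed, two
    between [dyad_delta] tensors. The vector (1, 1, 0) detects the coefficient of b^2 c^2. *)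
Definition probe : seq (elasticity R * elasticity R) :=
  [:: (quartic e1, quartic e1); (quartic e1, quartic e2);
      (quartic e1, quartic (vec3 1 1 0));
      (quartic e1, dyad_delta e1); (quartic e1, dyad_delta e2);
      (dyad_delta e1, dyad_delta e1); (dyad_delta e1, dyad_delta e2)].

Lemma quartic_axis (a : R) : quartic (vec3 a 0 0) = a ^+ 4 *: quartic e1.
Proof.
apply: coef_eq => i j k l; rewrite coef_scale !coef_quartic !dyad_vec3.
by move: i j k l; do 4 apply: ord3P; rewrite /=; ring.
Qed.

Lemma dyad_delta_axis (a : R) : dyad_delta (vec3 a 0 0) = a ^+ 2 *: dyad_delta e1.
Proof.
apply: coef_eq => i j k l; rewrite coef_scale !coef_dyad_delta !dyad_vec3.
by move: i j; do 2 apply: ord3P; move: k l; do 2 apply: ord3P; rewrite !mxE /=; ring.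
Qed.

(* Reflecting c to - c leaves only the even part of the quartic in (b, c), which
   three fixed quartics span. *)
Lemma quartic_even_plane (b c : R) :
  quartic (vec3 b c 0) = - quartic (vec3 b (- c) 0) +
   ((2 * b ^+ 4 - 2 * b ^+ 2 * c ^+ 2) *: quartic e1 +
    ((2 * c ^+ 4 - 2 * b ^+ 2 * c ^+ 2) *: quartic e2 +
     (b ^+ 2 * c ^+ 2) *: (quartic (vec3 1 1 0) + quartic (vec3 1 (-1) 0)))).
Proof.
apply: coef_eq => i j k l; rewrite -scaleN1r !(coef_add, coef_scale) !coef_quartic !dyad_vec3.
by move: i j k l; do 4 apply: ord3P; rewrite /=; ring.
Qed.

(** The same symmetrization in degree two, where two fixed tensors span the even part. *)
Lemma dyad_delta_even_plane (b c : R) :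
  dyad_delta (vec3 b c 0) = - dyad_delta (vec3 b (- c) 0) +
   ((2 * b ^+ 2) *: dyad_delta e1 + (2 * c ^+ 2) *: dyad_delta e2).
Proof.
apply: coef_eq => i j k l; rewrite -scaleN1r !(coef_add, coef_scale) !coef_dyad_delta !dyad_vec3.
by move: i j; do 2 apply: ord3P; move: k l; do 2 apply: ord3P; rewrite !mxE /=; ring.
Qed.

(** The half-turn [rot23 (-1) 0] about axis 1 fixes [C] and changes the sign of c. *)
Lemma polar_axis_reflect phi C (G : 'cV[R]_3 -> elasticity R) b c :
  SO3_invariant phi -> (forall Q, is_SO3 Q -> Q *m e1 = e1 -> rotate Q C = C) ->
  (forall Q u, is_SO3 Q -> rotate Q (G u) = G (Q *m u)) ->
  polar phi C (G (vec3 b (- c) 0)) = polar phi C (G (vec3 b c 0)).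
Proof.
move=> inv hC hG; have hQ : is_SO3 (rot23 (-1) 0) by apply: rot23_SO3; ring.
rewrite -[RHS](polar_rotate _ _ _ _ inv hQ) hC // ?hG // rot23_vec3.
  by congr (polar _ _ (G (vec3 _ _ _))); ring.
by congr vec3; ring.
Qed.

(** Normal position and evenness in c reduce the polar form on any two generators to the seven probe
    values. Linearity in each argument then makes it vanish everywhere, and [phi] with it. *)
Lemma quadratic_invariant_eq0 phi : quadratic_invariant phi ->
  all (fun p => polar phi p.1 p.2 == 0) probe -> forall C, phi C = 0.
Proof.
case=> quad inv /and5P[/eqP /= h1 /eqP /= h2 /eqP /= h3 /eqP /= h4].
case/and4P=> /eqP /= h5 /eqP /= h6 /eqP /= h7 _.
have lin C := polar_linear phi C quad.
have P0 C : polar phi C 0 = 0.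
  by have := lin C (-1) 0 0; rewrite scaler0 addr0; lra.
have PZ C a D : polar phi C (a *: D) = a * polar phi C D.
  by rewrite -[a *: D]addr0 lin P0 addr0.
have PD C D E : polar phi C (D + E) = polar phi C D + polar phi C E.
  by rewrite -[D in LHS]scale1r lin mul1r.
have PN C D : polar phi C (- D) = - polar phi C D by rewrite -scaleN1r PZ mulN1r.
have PZl C a D : polar phi (a *: C) D = a * polar phi C D by rewrite polarC PZ polarC.
have rq Q u : is_SO3 Q -> rotate Q (quartic u) = quartic (Q *m u).
  by rewrite rotate_quartic.
have rd Q u : is_SO3 Q -> rotate Q (dyad_delta u) = dyad_delta (Q *m u).
  exact: rotate_dyad_delta.
have fq Q : is_SO3 Q -> Q *m e1 = e1 -> rotate Q (quartic e1) = quartic e1.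
  by move=> /rq -> ->.
have fd Q : is_SO3 Q -> Q *m e1 = e1 -> rotate Q (dyad_delta e1) = dyad_delta e1.
  by move=> /rd -> ->.
have qq u v : polar phi (quartic u) (quartic v) = 0.
  move: u v; apply: SO3_pair_ind => [Q u v hQ|a b c].
    by rewrite -!rotate_quartic polar_rotate.
  rewrite quartic_axis PZl.
  suff -> : polar phi (quartic e1) (quartic (vec3 b c 0)) = 0.
    by rewrite mulr0.
  (* By reflection the quartics at c and - c have equal polar values, as do those at (1, 1, 0) and
     (1, -1, 0). The identity thus equates twice the wanted value with a combination of vanishing
     probe values. *)
  have := congr1 (polar phi (quartic e1)) (quartic_even_plane b c).
  rewrite !(PD, PZ, PN) !(polar_axis_reflect _ _ quartic) // h1 h2 h3; lra.
have qd u v : polar phi (quartic u) (dyad_delta v) = 0.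
  move: u v; apply: SO3_pair_ind => [Q u v hQ|a b c].
    by rewrite -rotate_quartic -rd // polar_rotate.
  rewrite quartic_axis PZl.
  suff -> : polar phi (quartic e1) (dyad_delta (vec3 b c 0)) = 0.
    by rewrite mulr0.
  have := congr1 (polar phi (quartic e1)) (dyad_delta_even_plane b c).
  rewrite !(PD, PZ, PN) !(polar_axis_reflect _ _ dyad_delta) // h4 h5; lra.
have dd u v : polar phi (dyad_delta u) (dyad_delta v) = 0.
  move: u v; apply: SO3_pair_ind => [Q u v hQ|a b c].
    by rewrite -!rd // polar_rotate.
  rewrite dyad_delta_axis PZl.
  suff -> : polar phi (dyad_delta e1) (dyad_delta (vec3 b c 0)) = 0.
    by rewrite mulr0.
  have := congr1 (polar phi (dyad_delta e1)) (dyad_delta_even_plane b c).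
  rewrite !(PD, PZ, PN) !(polar_axis_reflect _ _ dyad_delta) // h6 h7; lra.
apply: quadratic_form_polar0 => // C D.
move: D; apply: linear_form_eq0 => // [u|u]; rewrite polarC.
  by move: C; apply: linear_form_eq0.
by move: C; apply: linear_form_eq0 => // v; rewrite polarC.
Qed.

(** * The seven values of the seven forms *)

Lemma dilatation_mxD C D : dilatation_mx (C + D) = dilatation_mx C + dilatation_mx D.
Proof.
by apply/matrixP => k l; rewrite !mxE -big_split; apply: eq_bigr => i _; rewrite coef_add.
Qed.

Lemma voigt_mxD C D : voigt_mx (C + D) = voigt_mx C + voigt_mx D.
Proof.
by apply/matrixP => k l; rewrite !mxE -big_split; apply: eq_bigr => i _; rewrite coef_add.
Qed.

Lemma mxdotC (X Y : 'M[R]_3) : mxdot X Y = mxdot Y X.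
Proof. by do 2![apply: eq_bigr => ? _]; rewrite mulrC. Qed.

Lemma mxdotDl (X Y Z : 'M[R]_3) : mxdot (X + Y) Z = mxdot X Z + mxdot Y Z.
Proof. by rewrite !mxdotE mulmxDl raddfD. Qed.

Lemma mxdotDr (X Y Z : 'M[R]_3) : mxdot X (Y + Z) = mxdot X Y + mxdot X Z.
Proof. by rewrite ![mxdot X _]mxdotC mxdotDl. Qed.

Lemma mxdotZl a (X Y : 'M[R]_3) : mxdot (a *: X) Y = a * mxdot X Y.
Proof. by rewrite !mxdotE -scalemxAl mxtraceZ. Qed.

Lemma mxdotZr a (X Y : 'M[R]_3) : mxdot X (a *: Y) = a * mxdot X Y.
Proof. by rewrite ![mxdot X _]mxdotC mxdotZl. Qed.

Lemma mxdot1l (X : 'M[R]_3) : mxdot 1%:M X = \tr X.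
Proof. by rewrite mxdotE mul1mx mxtrace_tr. Qed.

Lemma mxdot1r (X : 'M[R]_3) : mxdot X 1%:M = \tr X.
Proof. by rewrite mxdotE trmx1 mulmx1. Qed.

Lemma mxdot0l (X : 'M[R]_3) : mxdot 0 X = 0.
Proof. by rewrite mxdotE mul0mx mxtrace0. Qed.

Lemma mxdot0r (X : 'M[R]_3) : mxdot X 0 = 0.
Proof. by rewrite mxdotE trmx0 mulmx0 mxtrace0. Qed.

Lemma dilatation_mx_quartic u :
  dilatation_mx (quartic u) = \tr (dyad u) *: dyad u.
Proof.
apply/matrixP => k l; rewrite mxE [RHS]mxE big_distrl; apply: eq_bigr => i _.
by rewrite coef_quartic !dyadE /=; ring.
Qed.

Lemma voigt_mx_quartic u : voigt_mx (quartic u) = \tr (dyad u) *: dyad u.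
Proof.
apply/matrixP => k l; rewrite mxE [RHS]mxE big_distrl; apply: eq_bigr => i _.
by rewrite coef_quartic !dyadE /=; ring.
Qed.

Lemma dilatation_mx_dyad_delta u :
  dilatation_mx (dyad_delta u) = \tr (dyad u) *: 1%:M + 3 *: dyad u.
Proof.
apply/matrixP; apply: ord3P; apply: ord3P.
all: rewrite mxE [RHS]mxE [X in _ = X + _]mxE [X in _ = _ + X]mxE /mxtrace !sum3.
all: by rewrite !coef_dyad_delta !dyadE !mxE /=; ring.
Qed.

Lemma voigt_mx_dyad_delta u : voigt_mx (dyad_delta u) = 2 *: dyad u.
Proof.
apply/matrixP; apply: ord3P; apply: ord3P; rewrite mxE [RHS]mxE !sum3.
all: by rewrite !coef_dyad_delta !dyadE !mxE /=; ring.
Qed.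

(** * Polar forms of the seven forms on pairs of generators *)

Definition tensor_dot C D : R :=
  \sum_i \sum_j \sum_k \sum_l coef C i j k l * coef D i j k l.

Lemma sum_mxdot (X Y Z W : 'M[R]_3) :
  \sum_i \sum_j \sum_k \sum_l (X i j * Y k l) * (Z i j * W k l) = mxdot X Z * mxdot Y W.
Proof.
rewrite /mxdot big_distrl; apply: eq_bigr => i _; rewrite big_distrl; apply: eq_bigr => j _.
rewrite big_distrr; apply: eq_bigr => k _; rewrite big_distrr; apply: eq_bigr => l _.
by rewrite /=; ring.
Qed.

(** The inner product of two tensor products factors into Frobenius products. Two terms on each side
    suffice for both kinds of generators. *)
Lemma tensor_dotE (X Y Z W X' Y' Z' W' : 'M[R]_3) C D :
  (forall i j k l, coef C i j k l = X i j * Y k l + Z i j * W k l) ->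
  (forall i j k l, coef D i j k l = X' i j * Y' k l + Z' i j * W' k l) ->
  tensor_dot C D =
    mxdot X X' * mxdot Y Y' + mxdot X Z' * mxdot Y W' +
    (mxdot Z X' * mxdot W Y' + mxdot Z Z' * mxdot W W').
Proof.
move=> hC hD; rewrite -!sum_mxdot -!big_split; apply: eq_bigr => i _ /=.
rewrite -!big_split; apply: eq_bigr => j _ /=; rewrite -!big_split; apply: eq_bigr => k _ /=.
by rewrite -!big_split; apply: eq_bigr => l _ /=; rewrite hC hD; ring.
Qed.

Lemma polar_B1 C D : polar (@B1 R) C D = 2 * tensor_dot C D.
Proof.
rewrite /polar /B1 /tensor_dot.
apply/eqP; rewrite !subr_eq; apply/eqP.
rewrite big_distrr -!big_split; apply: eq_bigr => i _ /=.
rewrite big_distrr -!big_split; apply: eq_bigr => j _ /=.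
rewrite big_distrr -!big_split; apply: eq_bigr => k _ /=.
rewrite big_distrr -!big_split; apply: eq_bigr => l _ /=.
by rewrite coef_add; ring.
Qed.

(* Row m, column n: the polar form of [tnth seven_forms n] at [nth probe m]. *)
Definition probe_table : seq (seq nat) :=
  [:: [:: 2;  2;  2;  2;  2;  2;  2];
      [:: 2;  2;  2;  0;  0;  0;  0];
      [:: 8;  8;  8;  2;  4;  4;  4];
      [:: 4; 12;  8;  4;  8;  6;  4];
      [:: 4; 12;  8;  0;  2;  1;  0];
      [:: 8; 72; 24; 16; 36; 16;  8];
      [:: 8; 72; 24;  4; 18;  4;  0]]%N.

(** The contractions are additive in the tensor, so each form built from them polarizes by
    bilinearity; [B1] polarizes into [tensor_dot]. *)
Lemma polar_seven_forms C D (n : 'I_7) :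
  let t := dilatation_mx in let w := voigt_mx in
  polar (tnth (seven_forms R) n) C D =
  nth 0 [:: 2 * \tr (w C) * \tr (w D);
            2 * \tr (t C) * \tr (t D);
            \tr (w C) * \tr (t D) + \tr (t C) * \tr (w D);
            2 * tensor_dot C D;
            2 * mxdot (t C) (t D);
            mxdot (t C) (w D) + mxdot (t D) (w C);
            2 * mxdot (w C) (w D)] n.
Proof.
move=> t w; case: n => [[|[|[|[|[|[|[|//]]]]]]] hn]; rewrite (tnth_nth (fun=> 0)) /=.
4: exact: polar_B1.
all: rewrite /polar ?B2E ?B3E ?B4E ?A1E ?A2E ?dilatation_mxD ?voigt_mxD.
1-3: by rewrite !raddfD /=; ring.
all: rewrite !mxdotDl !mxdotDr; rewrite /t /w.
2: by ring.
- by rewrite [mxdot (_ D) (_ C)]mxdotC; ring.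
- by rewrite [mxdot (_ D) (_ C)]mxdotC; ring.
Qed.

(** A zero product pads the quartic to the two-term shape of [tensor_dotE]. *)
Lemma coef_quartic0 u i j k l : coef (quartic u) i j k l =
  dyad u i j * dyad u k l + (0 : 'M_3) i j * (0 : 'M_3) k l.
Proof. by rewrite coef_quartic !mxE mulr0 addr0. Qed.

Definition generator_mxE := (dilatation_mx_quartic, voigt_mx_quartic,
  dilatation_mx_dyad_delta, voigt_mx_dyad_delta).

Definition mxdot_simp := (mxdot0l, mxdot0r, mxdot1l, mxdot1r, mxtrace1,
  mxtraceD, mxtraceZ, mxdotDl, mxdotDr, mxdotZl, mxdotZr).

(** Here a and b are the squared lengths of u and v, and p is the square of their scalar product;
    all values are polynomials in these three. *)
Lemma polar_quartic_quartic u v (n : 'I_7) :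
  let a := \tr (dyad u) in let b := \tr (dyad v) in
  let p := mxdot (dyad u) (dyad v) in
  polar (tnth (seven_forms R) n) (quartic u) (quartic v) =
  nth 0 [:: 2 * (a * b) ^+ 2; 2 * (a * b) ^+ 2; 2 * (a * b) ^+ 2; 2 * p ^+ 2;
            2 * a * b * p; 2 * a * b * p; 2 * a * b * p] n.
Proof.
move=> a b p; rewrite polar_seven_forms !generator_mxE.
rewrite (tensor_dotE _ _ _ _ _ _ _ _ _ _ (coef_quartic0 _) (coef_quartic0 _)).
have sym : mxdot (dyad v) (dyad u) = p by rewrite /p mxdotC.
rewrite !mxdot_simp sym -/a -/b -/p.
by case: n => [[|[|[|[|[|[|[|//]]]]]]] hn] /=; ring.
Qed.

Lemma polar_quartic_dyad_delta u v (n : 'I_7) :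
  let a := \tr (dyad u) in let b := \tr (dyad v) in
  let p := mxdot (dyad u) (dyad v) in
  polar (tnth (seven_forms R) n) (quartic u) (dyad_delta v) =
  nth 0 [:: 4 * a ^+ 2 * b; 12 * a ^+ 2 * b; 8 * a ^+ 2 * b; 4 * a * p;
            2 * a ^+ 2 * b + 6 * a * p; a ^+ 2 * b + 5 * a * p; 4 * a * p] n.
Proof.
move=> a b p; rewrite polar_seven_forms !generator_mxE.
rewrite (tensor_dotE _ _ _ _ _ _ _ _ _ _ (coef_quartic0 _) (coef_dyad_delta _)).
have sym : mxdot (dyad v) (dyad u) = p by rewrite /p mxdotC.
rewrite !mxdot_simp sym -/a -/b -/p.
by case: n => [[|[|[|[|[|[|[|//]]]]]]] hn] /=; ring.
Qed.

Lemma polar_dyad_delta_dyad_delta u v (n : 'I_7) :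
  let a := \tr (dyad u) in let b := \tr (dyad v) in
  let p := mxdot (dyad u) (dyad v) in
  polar (tnth (seven_forms R) n) (dyad_delta u) (dyad_delta v) =
  nth 0 [:: 8 * a * b; 72 * a * b; 24 * a * b; 4 * a * b + 12 * p;
            18 * a * b + 18 * p; 4 * a * b + 12 * p; 8 * p] n.
Proof.
move=> a b p; rewrite polar_seven_forms !generator_mxE.
rewrite (tensor_dotE _ _ _ _ _ _ _ _ _ _ (coef_dyad_delta _) (coef_dyad_delta _)).
have sym : mxdot (dyad v) (dyad u) = p by rewrite /p mxdotC.
rewrite !mxdot_simp sym -/a -/b -/p.
by case: n => [[|[|[|[|[|[|[|//]]]]]]] hn] /=; ring.
Qed.

Lemma polar_probe (m n : 'I_7) :
  let p := nth (0, 0) (probe) m in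
  polar (tnth (seven_forms R) n) p.1 p.2 = (nth 0%N (nth [::] probe_table m) n)%:R.
Proof.
have tr x y z : \tr (dyad (vec3 x y z)) = x ^+ 2 + y ^+ 2 + z ^+ 2.
  by rewrite /mxtrace sum3 !dyad_vec3.
have dot x y z x' y' z' : mxdot (dyad (vec3 x y z)) (dyad (vec3 x' y' z')) =
    (x * x' + y * y' + z * z') ^+ 2.
  by rewrite /mxdot !sum3 !dyad_vec3 /=; ring.
case: m n => [[|[|[|[|[|[|[|//]]]]]]] hm] n /=.
1-3: rewrite polar_quartic_quartic.
4-5: rewrite polar_quartic_dyad_delta.
6-7: rewrite polar_dyad_delta_dyad_delta.
all: rewrite !(tr, dot); case: n => [[|[|[|[|[|[|[|//]]]]]]] hn] /=; ring.
Qed.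

(** * Linear independence and spanning *)

Lemma polar_lincomb (I : finType) (a : I -> R) (F : I -> elasticity R -> R) C D :
  polar (fun C => \sum_n a n * F n C) C D = \sum_n a n * polar (F n) C D.
Proof.
by rewrite /polar -!sumrB; apply: eq_bigr => n _; rewrite !mulrBr.
Qed.

Lemma quadratic_invariantB phi psi : quadratic_invariant phi ->
  quadratic_invariant psi -> quadratic_invariant (fun C => phi C - psi C).
Proof.
move=> [qphi iphi] [qpsi ipsi]; split=> [|Q C hQ]; last by rewrite iphi ?ipsi.
by apply: quadratic_form_eq (quadratic_formZD (-1) _ _ qpsi qphi) => C /=; ring.
Qed.

Lemma quadratic_invariant_lincomb (I : finType) (a : I -> R) (F : I -> elasticity R -> R) :
  (forall n, quadratic_invariant (F n)) ->
  quadratic_invariant (fun C => \sum_n a n * F n C).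
Proof.
move=> h; split=> [|Q C hQ].
  apply: quadratic_form_sum => n.
  apply: quadratic_form_eq (quadratic_formZD (a n) _ _ (h n).1 quadratic_form0).
  by move=> C; rewrite addr0.
by apply: eq_bigr => n _; rewrite (h n).2.
Qed.

Lemma quadratic_invariant_seven_forms n : quadratic_invariant (tnth (seven_forms R) n).
Proof.
by split; [exact: quadratic_seven_forms | exact: invariant_seven_forms].
Qed.

Definition probe_polar phi (m : nat) :=
  let p := nth (0, 0) probe m in polar phi p.1 p.2.

Lemma probe_polar_lincomb (a : nat -> R) (m : 'I_7) :
  probe_polar (fun C => \sum_(n < 7) a n * tnth (seven_forms R) n C) m =
  \sum_(n < 7) a n * (nth 0%N (nth [::] probe_table m) n)%:R.
Proof.
rewrite /probe_polar polar_lincomb.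
by apply: eq_bigr => n _; rewrite -polar_probe.
Qed.

(** Polarizing a vanishing combination at the probes gives a homogeneous system with the invertible
    matrix [probe_table], which [lra] solves for each coefficient. *)
Lemma seven_forms_free (a : nat -> R) :
  (forall C, \sum_(n < 7) a n * tnth (seven_forms R) n C = 0) ->
  forall n, (n < 7)%N -> a n = 0.
Proof.
move=> h.
have E m : (m < 7)%N -> \sum_(n < 7) a n * (nth 0%N (nth [::] probe_table m) n)%:R = 0.
  move=> hm; rewrite -(probe_polar_lincomb a (Ordinal hm)).
  by rewrite /probe_polar /polar !h; ring.
have := (E 0 isT, E 1 isT, E 2 isT, E 3 isT, E 4 isT, E 5 isT, E 6 isT)%N.
rewrite !big_ord_recl !big_ord0 /= /bump /= !(addn0, addn1, add0n, add1n).
move=> [[[[[[h0 h1] h2] h3] h4] h5] h6].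
by move=> [|[|[|[|[|[|[|//]]]]]]] _; lra.
Qed.

(* The matrix applied to the seven values is the inverse of [probe_table]. *)
Definition seven_coordinates phi : seq R :=
  let l0 := probe_polar phi 0 in let l1 := probe_polar phi 1 in
  let l2 := probe_polar phi 2 in let l3 := probe_polar phi 3 in
  let l4 := probe_polar phi 4 in let l5 := probe_polar phi 5 in
  let l6 := probe_polar phi 6 in
  [:: - (5/8) * l0 + 11/4 * l1 - 1/4 * l2 + 7/8 * l3 - 5/4 * l4 - 5/32 * l5 + 3/16 * l6;
      - (1/8) * l0 + 5/4 * l1 - 1/4 * l2 + 5/8 * l3 - 3/4 * l4 - 5/32 * l5 + 3/16 * l6;
      3/4 * l0 - 7/2 * l1 + 1/2 * l2 - 3/2 * l3 + 2 * l4 + 5/16 * l5 - 3/8 * l6;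
      l0 + l1 - 1/2 * l2;
      - 4 * l1 + l2 - 2 * l3 + 2 * l4 + 1/2 * l5 - 1/2 * l6;
      - 2 * l0 + 10 * l1 - 2 * l2 + 5 * l3 - 5 * l4 - l5 + l6;
      3/2 * l0 - 15/2 * l1 + 3/2 * l2 - 3 * l3 + 3 * l4 + 1/2 * l5 - 1/2 * l6].

(** The coordinates are chosen so that the combination has the same probe values as [phi]. The
    difference is a quadratic invariant with all probe values zero, hence it vanishes. *)
Lemma seven_forms_span phi : quadratic_invariant phi -> forall C,
  phi C = \sum_(n < 7) nth 0 (seven_coordinates phi) n * tnth (seven_forms R) n C.
Proof.
move=> hphi C; apply/eqP; rewrite -subr_eq0; apply/eqP.
set a := nth 0 (seven_coordinates phi).
pose psi C := \sum_(n < 7) a n * tnth (seven_forms R) n C.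
have hpsi : quadratic_invariant psi.
  exact: quadratic_invariant_lincomb quadratic_invariant_seven_forms.
have E m : (m < 7)%N -> probe_polar phi m - probe_polar psi m = 0.
  move=> hm; rewrite (probe_polar_lincomb a (Ordinal hm)).
  rewrite !big_ord_recl big_ord0 /= /bump /= !(addn0, addn1, add0n, add1n) /a /seven_coordinates.
  by case: m hm => [|[|[|[|[|[|[|//]]]]]]] _ /=; lra.
apply: (quadratic_invariant_eq0 (fun C => phi C - psi C)); first exact: quadratic_invariantB.
apply/(all_nthP (0, 0)) => m hm; apply/eqP/(etrans _ (E m hm)).
by rewrite /probe_polar /polar; ring.
Qed.
End ElasticTensors.

Theorem mainTheorem3 (R : realType) :
  [/\ forall n : 'I_7, quadratic_invariant (tnth (seven_forms R) n),
      forall a : 'I_7 -> R,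
        (forall C : elasticity R,
           \sum_(n < 7) a n * tnth (seven_forms R) n C = 0) ->
        forall n : 'I_7, a n = 0
    & forall phi : elasticity R -> R, quadratic_invariant phi ->
        exists a : 'I_7 -> R, forall C : elasticity R,
          phi C = \sum_(n < 7) a n * tnth (seven_forms R) n C ].
Proof.
split=> [n|a h n|phi hphi]; first exact: quadratic_invariant_seven_forms.
  (* Coefficients on ordinals are extended to [nat] through [inord], which returns the same index
     below 7. *)
  rewrite -(inord_val n); apply: (seven_forms_free R (fun k => a (inord k))) => // C.
  by rewrite -[RHS](h C); apply: eq_bigr => i _; rewrite inord_val.
exists (fun n => nth 0 (seven_coordinates R phi) n); exact: seven_forms_span.
Qed.
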